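(* Let $(P_n(x))_{n\in\mathbb{N}_0}\subseteq\mathbb{R}[x]$ be a sequence given by $P_0(x)=1$, $P_1(x)=x$, $xP_n(x)=a_nP_{n+1}(x)+c_nP_{n-1}(x)$ $(n\in\mathbb{N})$ with $(c_n)_{n\in\mathbb{N}}\subseteq(0,1)$ and $a_n=1-c_n$, and assume that $(P_n(x))_{n\in\mathbb{N}_0}$ satisfies nonnegative linearization of products. Let $\mu$ be the orthogonalization probability measure of $(P_n(x))_{n\in\mathbb{N}_0}$. If $\mathrm{supp}\,\mu=[-a,a]$ for some $a\in(0,1]$, then $h(n)\geq 2$ for all $n\in\mathbb{N}$.
   Context: $\mathbb{N}=\{1,2,3,\ldots\}$ and $\mathbb{N}_0=\mathbb{N}\cup\{0\}$. A sequence $(P_n(x))_{n\in\mathbb{N}_0}$ given by such a recurrence satisfies $\deg P_n=n$ and $P_n(1)=1$ for all $n$, and it is orthogonal with respect to a unique probability Borel measure $\mu$ on $\mathbb{R}$ (the orthogonalization measure), meaning that $\int_{\mathbb{R}}P_m(x)P_n(x)\,\mathrm{d}\mu(x)\neq 0\Leftrightarrow m=n$; one has $|\mathrm{supp}\,\mu|=\infty$ and $\mathrm{supp}\,\mu\subseteq[-1,1]$. Nonnegative linearization of products means that in the (unique) expansions $P_m(x)P_n(x)=\sum_{k=0}^{m+n}g(m,n;k)P_k(x)$ all coefficients $g(m,n;k)$ $(m,n,k\in\mathbb{N}_0)$ are nonnegative. The Haar function is $h(n):=1/g(n,n;0)=1/\int_{\mathbb{R}}P_n^2(x)\,\mathrm{d}\mu(x)$;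 equivalently, $h(0)=1$ and $h(n)=\prod_{k=1}^n a_{k-1}/c_k$ for $n\in\mathbb{N}$, where $a_0:=1$. *)

(* Defs.v *)
From mathcomp Require Import all_boot all_order all_algebra.
From mathcomp Require Import all_classical all_reals all_analysis.

Set Implicit Arguments.
Unset Strict Implicit.
Unset Printing Implicit Defensive.

Import Order.TTheory GRing.Theory Num.Theory.
Import numFieldNormedType.Exports.

Local Open Scope classical_set_scope.
Local Open Scope ring_scope.

Definition recurrence (R : realType) (a c : nat -> R) (P : nat -> {poly R}) : Prop :=
  [/\ P 0%N = 1, P 1%N = 'X &
      forall n : nat, (1 <= n)%N ->
        'X * P n = a n *: P n.+1 + c n *: P n.-1].

(* Every P n below has degree n, so the expansion determines g m n k for
   k <= m + n; the values of g for k > m + n are irrelevant. *)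
Definition linearization (R : realType) (P : nat -> {poly R})
    (g : nat -> nat -> nat -> R) : Prop :=
  forall m n : nat, P m * P n = \sum_(k < (m + n).+1) g m n k *: P k.

Definition nonneg_linearization (R : realType) (g : nat -> nat -> nat -> R) : Prop :=
  forall m n k : nat, (k <= m + n)%N -> 0 <= g m n k.

Definition haar (R : realType) (g : nat -> nat -> nat -> R) (n : nat) : R :=
  1 / g n n 0%N.

(* Rintegral is total, hence the explicit integrability requirement. *)
Definition orthogonalization_measure (R : realType) (P : nat -> {poly R})
    (mu : probability (measurableTypeR R) R) : Prop :=
  forall m n : nat,
    mu.-integrable setT (fun x : measurableTypeR R => ((P m).[x] * (P n).[x])%:E) /\
    ((\int[mu]_x ((P m).[x] * (P n).[x]))%R <> 0 <-> m = n).

Definition supp (R : realType) (mu : probability (measurableTypeR R) R) : set R :=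
  [set x | forall U : set R, open U -> U x -> (0 < mu U)%E].

(* Main.v *)
(* Nonnegative combinations of the P_k are closed under products, so that
   int P_k^(2j) dmu <= P_k(1)^(2j) = 1 for all j; letting j tend to infinity,
   |P_k| <= 1 on supp mu. For n >= 1, P_n integrates to 0 and therefore cannot
   have constant sign on the interval supp mu: it has a zero x there. Evaluating
   P_n^2 = \sum_k g(n,n;k) P_k at x and at 1 gives
   0 = g(n,n;0) + \sum_(k >= 1) g(n,n;k) P_k(x) >= g(n,n;0) - (1 - g(n,n;0)),
   that is g(n,n;0) <= 1/2. *)
Require Import Defs.
From mathcomp Require Import all_boot all_order all_algebra.
From mathcomp Require Import all_classical all_reals all_analysis.
From mathcomp Require Import measurable_realfun.
From mathcomp Require Import lra.

Import Order.TTheory GRing.Theory Num.Theory.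
Import numFieldNormedType.Exports.

Local Open Scope classical_set_scope.
Local Open Scope ring_scope.

(** * Signs of polynomials on an interval and growth of powers *)

Lemma horner_gt0_itv (R : realType) (p : {poly R}) (a b : R) :
  a <= b -> 0 < p.[a] ->
  (forall x, x \in `[a, b] -> p.[x] != 0) ->
  forall x, x \in `[a, b] -> 0 < p.[x].
Proof.
move=> ab pa0 pn0 x xab; rewrite ltNge; apply/negP => px0.
have ax : a <= x by rewrite (itvP xab).
have /IVT : {within `[a, x], continuous (horner p)}.
  by apply: continuous_subspaceT; exact: continuous_horner.
move=> /(_ 0 ax)[|y yax /eqP]; last first.
  apply/negP/pn0; rewrite in_itv/= (itvP yax)/=.
  by apply: (@le_trans _ _ x); rewrite ?(itvP yax) ?(itvP xab).
by rewrite ge_min le_max px0 orbT (ltW pa0).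
Qed.

Lemma bernoulli_le (R : realFieldType) (r : R) j :
  1 <= r -> 1 + j%:R * (r - 1) <= r ^+ j.
Proof.
move=> r1; elim: j => [|j IH]; first by rewrite mul0r addr0.
rewrite exprS -natr1; apply: le_trans (ler_wpM2l _ IH); last lra.
(* This is exactly the slack in the induction step. *)
have : 0 <= j%:R * (r - 1) ^+ 2 by rewrite mulr_ge0 ?sqr_ge0.
lra.
Qed.

(** * Support of a probability measure and integrals of polynomials *)

Section Support.
Variables (R : realType) (mu : probability (measurableTypeR R) R).
Implicit Types p : {poly R}.

Definition pintegrable p :=
  mu.-integrable setT (fun x : measurableTypeR R => (p.[x])%:E).
Definition pint p : R := (\int[mu]_x p.[x])%R.

(** Each point off the support lies in a null open set, hence in a null ball with rational centre
    and radius; there are only countably many of these. *)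
Lemma supp_setC_negligible : mu.-negligible (~` supp mu).
Proof.
pose F (i : nat) : set (measurableTypeR R) :=
  if unpickle i is Some (c, r) then
    let B : set R := ball (@ratr R c) (ratr r) in
    if `[< mu B = 0%E >] then B else set0
  else set0.
have NF i : mu.-negligible (F i).
  rewrite /F; case: unpickle => [[c r]|]; last exact: negligible_set0.
  case: asboolP => [mB0|_]; last exact: negligible_set0.
  by apply/negligibleP => //; apply: measurable_ball.
have sub : ~` supp mu `<=` \bigcup_i F i.
  move=> x /existsNP[U /not_implyP[oU /not_implyP[Ux nU]]].
  have mU0 : mu U = 0%E.
    by apply/eqP; rewrite -measure_le0 leNgt; apply/negP.
  have [c [r [xB BU]]] := open_subball_rat oU (mem_set Ux).
  exists (pickle (c, r)); first exact: I.
  rewrite /F pickleK.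
  case: asboolP => [_|]; first exact: set_mem.
  case; apply/eqP; rewrite -measure_le0 -mU0 le_measure ?inE//.
    exact: measurable_ball.
  exact: open_measurable.
exact: (@negligibleS _ (measurableTypeR R) _ mu _ _ sub (negligible_bigcup NF)).
Qed.

Lemma root_in_itv p (a b : R) : a <= b -> mu (~` `[a, b]%classic) = 0%E ->
  pintegrable p -> pint p = 0 -> exists2 x, x \in `[a, b] & p.[x] = 0.
Proof.
move=> ab muC ip Ip; apply: contrapT => noroot.
have pn0 x : x \in `[a, b] -> p.[x] != 0.
  by move=> xab; apply/eqP => px0; apply: noroot; exists x.
(* The factor [p.[a]] makes [q] positive at [a], whatever the sign of [p] there. *)
pose q := p.[a] *: p.
have mA : measurable (`[a, b]%classic : set (measurableTypeR R)).
  exact: measurable_itv.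
have q_gt0 x : x \in `[a, b] -> 0 < q.[x].
  apply: horner_gt0_itv => // [|y yab].
    by rewrite hornerZ -expr2 exprn_even_gt0//= pn0// in_itv/= lexx.
  by rewrite hornerZ mulf_neq0 ?pn0// in_itv/= lexx.
have iq : mu.-integrable setT (fun x : measurableTypeR R => (q.[x])%:E).
  have := integrableZl measurableT p.[a] ip; apply: eq_integrable => // x _.
  by rewrite hornerZ EFinM.
have Iq : (\int[mu]_x (q.[x])%:E = 0)%E.
  transitivity ((p.[a])%:E * \int[mu]_x (p.[x])%:E)%E.
    rewrite -integralZl//; apply: eq_integral => x _.
    by rewrite hornerZ EFinM.
  rewrite -[X in (_ * X)%E]fineK; last exact: integrable_fin_num.
  by move: Ip; rewrite /pint /Rintegral => ->; rewrite mule0.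
(* Since [q] equals its absolute value on the interval and the complement is null, [q] vanishes
   almost everywhere on the interval. Being positive there, it forces the interval to be null,
   against total mass 1. *)
have IA : (\int[mu]_(x in `[a, b]%classic) `|(q.[x])%:E| = 0)%E.
  rewrite -Iq (negligible_integral (measurableC mA) measurableT iq muC).
  rewrite setTD setCK; apply: eq_integral => x; rewrite inE/= => xab.
  by rewrite /= gtr0_norm// q_gt0.
have mq : measurable_fun `[a, b]%classic (fun x : measurableTypeR R => (q.[x])%:E).
  apply/measurable_EFinP; exact: measurable_poly.
have [N [mN N0 sN]] := (ae_eq_integral_abs mu mA mq).1 IA.
have A0 : mu `[a, b]%classic = 0%E.
  apply/eqP; rewrite -measure_le0 -N0 le_measure ?inE// => x xab.
  apply: sN => /= /(_ xab) [] /eqP.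
  by rewrite gt_eqF// q_gt0.
have := probability_setC mu mA; rewrite muC A0 sube0 => /eqP.
by rewrite eq_sym onee_eq0.
Qed.

(* Markov's inequality for [q ^+ j], with [j] tending to infinity. *)
Lemma le1_on_supp (q : {poly R}) (x : R) : (forall y, 0 <= q.[y]) ->
  (forall j, pintegrable (q ^+ j)) -> (forall j, pint (q ^+ j) <= 1) ->
  supp mu x -> q.[x] <= 1.
Proof.
move=> q0 iq Iq sx; rewrite leNgt; apply/negP => qx1.
(* A level strictly between 1 and [q.[x]]: the set [U] where [q] exceeds it is an open neighbourhood
   of [x], so it has positive mass [m]. *)
pose r := (1 + q.[x]) / 2.
have r1 : 1 < r by rewrite /r; lra.
have rq : r < q.[x] by rewrite /r; lra.
pose U : set (measurableTypeR R) := [set y | r < q.[y]].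
have oU : open (U : set R).
  by apply: open_comp (@open_gt _ r) => y _; exact: continuous_horner.
have mU : measurable U by exact: open_measurable.
have := sx _ oU rq.
rewrite -[mu _]fineK ?fin_num_measure// lte_fin.
set m := fine _ => m0.
have iqU j : mu.-integrable U (fun y : measurableTypeR R => ((q ^+ j).[y])%:E).
  exact: (integrableS measurableT mU (@subsetT _ _) (iq j)).
have bound j : r ^+ j * m <= 1.
  apply: le_trans (Iq j).
  rewrite -Rintegral_cst//.
  apply: (@le_trans _ _ (\int[mu]_(y in U) (q ^+ j).[y])).
    apply: le_Rintegral => //.
    - exact: finite_measure_integrable_cst.
    - exact: iqU.
    - move=> y Uy; rewrite horner_exp lerXn2r ?nnegrE ?q0 ?ltW//.
      by rewrite (lt_trans _ r1).
  rewrite /pint /Rintegral fine_le//.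
  - exact: (integrable_fin_num mU (iqU j)).
  - exact: (integrable_fin_num measurableT (iq j)).
  apply: ge0_subset_integral => //.
    apply/measurable_EFinP; exact: measurable_poly.
  by move=> y _; rewrite lee_fin horner_exp exprn_ge0.
have r10 : 0 < (r - 1) * m by rewrite mulr_gt0// subr_gt0.
(* For [j] beyond [1 / ((r - 1) * m)], Bernoulli's inequality gives [r ^+ j * m > 1], contradicting
   [bound]. *)
have := archi_boundP (ltW (divr_gt0 ltr01 r10)).
set j := Num.Def.archi_bound _; rewrite ltr_pdivrMr// => jlt.
have := bound j; have := bernoulli_le _ _ j (ltW r1).
by move=> /(ler_wpM2r (ltW m0)); nra.
Qed.
End Support.

(** * The convex cone spanned by the [P k] *)

Section Conic.
Variables (R : realType) (P : nat -> {poly R}).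

(** The inductive form lets closure properties and integral bounds be proved one generator at a
    time, without naming coefficients. *)
Inductive conic : {poly R} -> Prop :=
| conic0 : conic 0
| conicDZ w k p : 0 <= w -> conic p -> conic (w *: P k + p).

Lemma conic_gen k : conic (P k).
Proof.
rewrite -[P k]addr0 -[P k]scale1r.
by apply: conicDZ => //; exact: conic0.
Qed.

Lemma conicD p q : conic p -> conic q -> conic (p + q).
Proof.
by move=> + cq; elim=> [|w k p' w0 _ IH]; rewrite ?add0r// -addrA; exact: conicDZ.
Qed.

Lemma conicZ w p : 0 <= w -> conic p -> conic (w *: p).
Proof.
move=> w0; elim=> [|v k p' v0 _ IH]; first by rewrite scaler0; exact: conic0.
by rewrite scalerDr scalerA; apply: conicDZ; rewrite ?mulr_ge0.
Qed.

(** By bilinearity it suffices to multiply two generators, where nonnegative linearization applies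
    directly. *)
Lemma conicM (g : nat -> nat -> nat -> R) p q :
  linearization P g -> nonneg_linearization g ->
  conic p -> conic q -> conic (p * q).
Proof.
move=> P_lin g_ge0 + cq; elim=> [|w m p' w0 _ IH].
  by rewrite mul0r; exact: conic0.
rewrite mulrDl; apply: conicD => //; rewrite -scalerAl; apply: conicZ => //.
elim: cq => [|v n q' v0 _ IHq]; first by rewrite mulr0; exact: conic0.
rewrite mulrDr; apply: conicD => //; rewrite -scalerAr; apply: conicZ => //.
rewrite P_lin; elim/big_ind: _ => [|x y|i _]; [exact: conic0|exact: conicD|].
by apply: conicZ (conic_gen i); apply: g_ge0; rewrite -ltnS.
Qed.

End Conic.

(** * Integrals of combinations of the [P k] *)

Section Orthogonality.
Variables (R : realType) (P : nat -> {poly R}).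
Variables (mu : probability (measurableTypeR R) R).
Hypotheses (P0 : P 0%N = 1) (P_mu : orthogonalization_measure P mu).

Lemma pintegrable_P k : pintegrable R mu (P k).
Proof.
have [+ _] := P_mu k 0; apply: eq_integrable => // x _.
by rewrite P0 hornerC mulr1.
Qed.

(** Orthogonality against [P 0 = 1] for positive [k]; total mass for [k = 0]. *)
Lemma pint_P k : pint R mu (P k) = (k == 0%N)%:R.
Proof.
have [_ Ik] := P_mu k 0; case: eqP => [->|/eqP k0].
  rewrite /pint P0.
  transitivity (\int[mu]_x (1 : R)); first by apply: eq_Rintegral => x _; rewrite hornerC.
  by rewrite Rintegral_cst// mul1r; apply: (congr1 fine (probability_setT mu)).
apply/eqP; apply: contraNT k0 => /eqP I0; apply/eqP/Ik.
rewrite (_ : Rintegral _ _ _ = pint R mu (P k))//.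
by apply: eq_Rintegral => x _; rewrite P0 hornerC mulr1.
Qed.

Lemma pintDZ w p q : pintegrable R mu p -> pintegrable R mu q ->
  pintegrable R mu (w *: p + q) /\
  pint R mu (w *: p + q) = w * pint R mu p + pint R mu q.
Proof.
move=> ip iq; have iwp := integrableZl measurableT w ip; split.
  have := integrableD measurableT iwp iq; apply: eq_integrable => // x _.
  by rewrite hornerD hornerZ EFinD EFinM.
rewrite /pint -RintegralZl// -RintegralD//.
by apply: eq_Rintegral => x _; rewrite hornerD hornerZ.
Qed.

Lemma pint0 : pintegrable R mu 0 /\ pint R mu 0 = 0.
Proof.
split; first by apply: eq_integrable (integrable0 mu setT) => // x _; rewrite horner0.
transitivity (\int[mu]_x (0 : R)); first by apply: eq_Rintegral => x _; rewrite horner0.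
by rewrite Rintegral_cst// mul0r.
Qed.

(** Each generator has integral 0 or 1, hence at most its value at 1, and nonnegative weights
    preserve this comparison. *)
Lemma conic_pint p : (forall k, (P k).[1] = 1) -> conic R P p ->
  pintegrable R mu p /\ pint R mu p <= p.[1].
Proof.
move=> P1; elim=> [|w k p' w0 _ [ip Ip]].
  by have [i0 ->] := pint0; rewrite horner0.
have [iwp ->] := pintDZ w _ _ (pintegrable_P k) ip; split => //.
rewrite hornerD hornerZ P1 pint_P lerD// ler_wpM2l//.
by case: (k == 0%N).
Qed.

(** Applied to the linearization of [P n * P n], this identifies [g n n 0] with the integral of the
    square of [P n]. *)
Lemma pint_sum_P (w : nat -> R) N :
  pintegrable R mu (\sum_(k < N.+1) w k *: P k) /\
  pint R mu (\sum_(k < N.+1) w k *: P k) = w 0%N.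
Proof.
elim: N => [|N [iN IN]].
  rewrite big_ord_recl big_ord0; have [i0 I0] := pint0.
  have [? ->] := pintDZ (w 0%N) _ _ (pintegrable_P 0) i0.
  by split=> //; rewrite I0 pint_P addr0 mulr1.
rewrite big_ord_recr /= addrC.
have [? ->] := pintDZ (w N.+1) _ _ (pintegrable_P N.+1) iN.
by rewrite IN pint_P mulr0 add0r.
Qed.

End Orthogonality.

(** At 1 the recurrence becomes [1 = (1 - c n) * (P n.+1).[1] + c n], where [1 - c n] is nonzero;
    the induction carries two consecutive values. *)
Lemma horner1_P (R : realType) (a c : nat -> R) (P : nat -> {poly R}) :
  (forall n, (1 <= n)%N -> 0 < c n < 1) ->
  (forall n, (1 <= n)%N -> a n = 1 - c n) ->
  recurrence a c P -> forall n, (P n).[1] = 1.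
Proof.
move=> c01 a_def [P0 P1 Prec] n.
suff : (P n).[1] = 1 /\ (P n.+1).[1] = 1 by case.
elim: n => [|n [IH0 IH1]]; first by rewrite P0 P1 hornerC hornerX.
split=> //; have := congr1 (horner^~ 1) (Prec n.+1 isT).
rewrite hornerM hornerX hornerD !hornerZ /= IH0 IH1 a_def// !mulr1.
have /andP[_ c1] := c01 n.+1 isT => E.
have a0 : 1 - c n.+1 != 0 by rewrite subr_eq0 gt_eqF.
by apply: (mulfI a0); lra.
Qed.

(** * The lower bound on the Haar function *)

Theorem corollary2p3 (R : realType) (a c : nat -> R) (P : nat -> {poly R})
    (g : nat -> nat -> nat -> R)
    (mu : probability (measurableTypeR R) R) (b : R)
    (c_in01 : forall n : nat, (1 <= n)%N -> 0 < c n < 1)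
    (a_def : forall n : nat, (1 <= n)%N -> a n = 1 - c n)
    (P_rec : recurrence a c P)
    (P_lin : linearization P g)
    (g_ge0 : nonneg_linearization g)
    (P_mu : orthogonalization_measure P mu)
    (b_gt0 : 0 < b) (b_le1 : b <= 1)
    (supp_mu : supp mu = `[- b, b]%classic) :
  forall n : nat, (1 <= n)%N -> 2 <= haar g n.
Proof.
move=> n n1; have P1 := horner1_P _ _ _ _ c_in01 a_def P_rec.
have [P0 _ _] := P_rec.
have root_n : exists2 x, x \in `[- b, b] & (P n).[x] = 0.
  apply: (root_in_itv _ mu); first by lra.
  - have := supp_setC_negligible _ mu; rewrite supp_mu => /negligibleP; apply.
    apply: measurableC; exact: measurable_itv.
  - exact: pintegrable_P.
  - by rewrite (pint_P _ P)// gtn_eqF.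
case: root_n => x xb Pnx.
have sx : supp mu x by rewrite supp_mu.
have Pk_geN1 k : -1 <= (P k).[x].
  suff : (P k * P k).[x] <= 1 by rewrite hornerM; nra.
  have cP j : conic R P ((P k * P k) ^+ j).
    elim: j => [|j IH]; first by rewrite expr0 -P0; exact: conic_gen.
    rewrite exprS; apply: (conicM _ _ g) => //.
    by apply: (conicM _ _ g) => //; exact: conic_gen.
  apply: (le1_on_supp _ mu) => // [y|j|j].
  - by rewrite hornerM -expr2 sqr_ge0.
  - by have [] := conic_pint _ _ _ P0 P_mu _ P1 (cP j).
  - have [_] := conic_pint _ _ _ P0 P_mu _ P1 (cP j).
    by rewrite horner_exp hornerM P1 mulr1 expr1n.
have evP y : (P n).[y] * (P n).[y] =
    g n n 0%N + \sum_(k < n + n) g n n k.+1 * (P k.+1).[y].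
  rewrite -hornerM P_lin big_ord_recl hornerD hornerZ P0 hornerC mulr1.
  by rewrite horner_sum; congr (_ + _); apply: eq_bigr => i _; rewrite hornerZ.
(* Strict positivity matters: division by zero yields 0, which would make [haar g n] vanish. *)
have g0_neq0 : g n n 0%N != 0.
  have [_ [_ /(_ erefl) I0]] := P_mu n n; apply/eqP => g0; apply: I0.
  have [_] := pint_sum_P _ _ _ P0 P_mu (g n n) (n + n); rewrite -P_lin g0 => <-.
  by apply: eq_Rintegral => y _; rewrite hornerM.
have g0_ge0 : 0 <= g n n 0%N by apply: g_ge0.
have sum1 : g n n 0%N + \sum_(k < n + n) g n n k.+1 = 1.
  have := evP 1; rewrite P1 mulr1 => ->; congr (_ + _).
  by apply: eq_bigr => i _; rewrite P1 mulr1.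
(* By [sum1] the first sum is [1 - g n n 0]; as [x] is a zero of [P n], the second is [- g n n 0].
   Hence [2 * g n n 0 <= 1]. *)
have sum_ge0 : 0 <= \sum_(k < n + n) g n n k.+1 +
    \sum_(k < n + n) g n n k.+1 * (P k.+1).[x].
  rewrite -big_split/=; apply: sumr_ge0 => i _.
  rewrite -[X in X + _]mulr1 -mulrDr mulr_ge0//; first by apply: g_ge0; rewrite ltn_ord.
  by have := Pk_geN1 i.+1; lra.
have := evP x; rewrite Pnx mul0r => sum0.
rewrite /haar ler_pdivlMr; [lra|].
by rewrite lt_neqAle eq_sym g0_neq0.
Qed.
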